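(* Let $N$ be a finite set with $n=|N|\geq 2$. Then the function $S\mapsto|\mathrm{Inv}(S)|$, defined for non-empty geodetically convex subsets $S$ of $\Upsilon(N)$ and extended by the convention $|\mathrm{Inv}(\emptyset)|:=-1$, is a height function for the lattice of geodetically convex subsets of $\Upsilon(N)$ (in the permutohedral graph over $N$), ordered by inclusion.
   Context: $N$ is a finite non-empty set, $n=|N|$, $[n]=\{1,\ldots,n\}$. An enumeration of $N$ is a bijection $\varepsilon:[n]\to N$; $\Upsilon(N)$ is the set of all enumerations of $N$. The permutohedral graph over $N$ is the undirected (connected) graph with node set $\Upsilon(N)$ in which $\varepsilon,\eta$ are adjacent iff there is $1\leq i<n$ with $\varepsilon(i)=\eta(i+1)$, $\varepsilon(i+1)=\eta(i)$ and $\varepsilon(k)=\eta(k)$ for all $k\in[n]\setminus\{i,i+1\}$. Such an edge is labelled by the two-element set $\{u,v\}=\{\varepsilon(i),\varepsilon(i+1)\}$, written $\varepsilon\stackrel{uv}{\longleftrightarrow}\eta$. A geodesic between two nodes is a walk between them of shortest possible length. A set $S$ of nodes is geodetically convex if, for all $\varepsilon,\eta\in S$, every node on every geodesic between $\varepsilon$ and $\eta$ belongs to $S$ (in particular $\emptyset$ is geodetically convex). The geodetically convex sets, being closed under intersection, form a lattice under inclusion. For non-empty $S\subseteq\Upsilon(N)$, the set of inversions within $S$ is $\mathrm{Inv}(S)=\{\{u,v\}\subseteq N: \text{there exist }\varepsilon,\eta\in S\text{ with }\varepsilon\stackrel{uv}{\longleftrightarrow}\eta\}$. A height function for a poset $(L,\preceq)$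 is a function $h:L\to\mathbb{Z}$ such that for all $l,u\in L$: if $l\prec u$ then $h(l)<h(u)$; and if $u$ covers $l$ (i.e. $l\prec u$ and there is no $e\in L$ with $l\prec e\prec u$) then $h(u)=h(l)+1$. *)

(* Defs.v *)
From HB Require Import structures.
From mathcomp Require Import all_boot all_order all_algebra.
From mathcomp Require Import boolp.

Set Implicit Arguments.
Unset Strict Implicit.
Unset Printing Implicit Defensive.

Import Order.TTheory.

Section HeightFunction.
Variables (d : Order.disp_t) (L : porderType d).

Definition covers (u l : L) : Prop :=
  (l < u)%O /\ ~ exists e : L, (l < e)%O /\ (e < u)%O.

Definition height_function (h : L -> int) : Prop :=
  forall l u : L,
    ((l < u)%O -> (h l < h u)%R) /\ (covers u l -> h u = (h l + 1)%R).

End HeightFunction.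

Section GeodeticConvexity.
Variables (T : finType) (e : rel T).

(* [p] lists the nodes of the walk after its initial node [x]. *)
Definition walk (x y : T) (p : seq T) : Prop := path e x p /\ last x p = y.

Definition geodesic (x y : T) (p : seq T) : Prop :=
  walk x y p /\ forall q : seq T, walk x y q -> size p <= size q.

Definition geodetically_convex (S : {set T}) : Prop :=
  forall x y : T, x \in S -> y \in S ->
  forall p : seq T, geodesic x y p ->
  forall z : T, z \in x :: p -> z \in S.

Lemma geodetically_convexT : geodetically_convex [set: T].
Proof. by move=> *; rewrite inE. Qed.

Lemma geodetically_convexI (A B : {set T}) :
  geodetically_convex A -> geodetically_convex B ->
  geodetically_convex (A :&: B).
Proof.
move=> cA cB x y /setIP[xA xB] /setIP[yA yB] p gp z zp; apply/setIP.
by split; [apply: cA gp _ zp | apply: cB gp _ zp].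
Qed.

Record convex_set := ConvexSet {
  cset :> {set T};
  csetP : `[< geodetically_convex cset >] }.

HB.instance Definition _ := [isSub for cset].
HB.instance Definition _ := [Finite of convex_set by <:].

Definition convex_le (A B : convex_set) : bool := cset A \subset cset B.

Fact convex_le_refl : reflexive convex_le.
Proof. by move=> A; rewrite /convex_le subxx. Qed.

Fact convex_le_anti : antisymmetric convex_le.
Proof. by move=> A B AB; apply/val_inj/eqP; rewrite eqEsubset. Qed.

Fact convex_le_trans : transitive convex_le.
Proof. by move=> B A C; apply: subset_trans. Qed.

Fact convex_display : Order.disp_t. Proof. exact: (Order.Disp tt tt). Qed.

HB.instance Definition _ := Order.Le_isPOrder.Build convex_display convex_set
  convex_le_refl convex_le_anti convex_le_trans.

Fact convex_meet_subproof (A B : convex_set) :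
  `[< geodetically_convex (cset A :&: cset B) >].
Proof. by apply/asboolP/geodetically_convexI; apply/asboolP/csetP. Qed.

Definition convex_meet (A B : convex_set) : convex_set :=
  ConvexSet (convex_meet_subproof A B).

Fact convex_join_subproof (A B : convex_set) :
  `[< geodetically_convex
        (\bigcap_(C : convex_set | cset A :|: cset B \subset cset C) cset C) >].
Proof.
apply/asboolP; elim/big_ind: _ => [||C _].
- exact: geodetically_convexT.
- exact: geodetically_convexI.
- exact/asboolP/csetP.
Qed.

Definition convex_join (A B : convex_set) : convex_set :=
  ConvexSet (convex_join_subproof A B).

Fact convex_meetP (X A B : convex_set) :
  (X <= convex_meet A B)%O = (X <= A)%O && (X <= B)%O.
Proof. exact: subsetI. Qed.

Fact convex_joinP (A B X : convex_set) :
  (convex_join A B <= X)%O = (A <= X)%O && (B <= X)%O.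
Proof.
rewrite {2 3}/Order.le /= /convex_le -subUset; apply/idP/idP => [|ABX].
  by apply: subset_trans; apply/bigcapsP.
exact: bigcap_inf.
Qed.

HB.instance Definition _ :=
  Order.POrder_MeetJoin_isLattice.Build convex_display convex_set
    convex_meetP convex_joinP.

End GeodeticConvexity.

Section PermutohedralGraph.
Variable N : finType.

(* The set [n] is rendered by the ordinals below [#|N|], hence positions are
   numbered from 0. *)
Definition enumeration : Type :=
  {f : {ffun 'I_#|N| -> N} | injectiveb f && [forall x, x \in codom f]}.

HB.instance Definition _ := Finite.on enumeration.

Definition enum_at (eps : enumeration) (i : 'I_#|N|) : N := val eps i.

Definition swapped_at (i j : 'I_#|N|) (eps eta : enumeration) : bool :=
  [&& j == i.+1 :> nat,
      enum_at eps i == enum_at eta j,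
      enum_at eps j == enum_at eta i &
      [forall k, (k \notin [set i; j]) ==> (enum_at eps k == enum_at eta k)]].

Definition permutohedral : rel enumeration :=
  fun eps eta => [exists i, exists j, swapped_at i j eps eta].

Definition labelled_edge (A : {set N}) (eps eta : enumeration) : bool :=
  [exists i, exists j,
    swapped_at i j eps eta && (A == [set enum_at eps i; enum_at eps j])].

Definition Inv (S : {set enumeration}) : {set {set N}} :=
  [set A | [exists eps in S, exists eta in S, labelled_edge A eps eta]].

Definition card_Inv (S : {set enumeration}) : int :=
  if S == set0 then (- 1)%R else Posz #|Inv S|.

End PermutohedralGraph.

(* Main.v *)
Require Import Defs.
From mathcomp Require Import all_boot all_order all_algebra.
From mathcomp Require Import perm boolp zify.

(** For enumerations [x], [y] let D(x, y) be the set of pairs [(a, b)] with [a]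
before [b] in [x] and [b] before [a] in [y].  An edge of the permutohedral graph
reverses exactly one pair, and any two distinct enumerations admit an edge from
the first that shrinks D; hence the distance is #|D(x, y)|, and geodesics keep
every pair on whose order their ends agree.  Consequently the enumerations
respecting a given set of ordered pairs form a convex set, and conversely a
non-empty convex set [S] consists of all enumerations respecting the order
[common S] shared by its members, while Inv S collects the pairs unrelated in
[common S].  If S < S' are convex and non-empty, a geodesic leaves S inside S'
along some edge reversing a pair (u, v) of [common S].  Then {u, v} is in
Inv S' but not in Inv S, and the enumerations respecting all pairs of
[common S] but (u, v) form a convex set above S and inside S'; if S' covers S,
this set is S', and {u, v} is the only new inversion. *)

Set Implicit Arguments.
Unset Strict Implicit.
Unset Printing Implicit Defensive.

(** * Positions in an enumeration and the strict total order they induce *)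

Section Positions.
Variable N : finType.
Implicit Types (x y z : enumeration N) (a b c d : N) (i j k : 'I_#|N|).

Lemma enum_at_inj x : injective (enum_at x).
Proof. by case/andP: (valP x) => /injectiveP. Qed.

Lemma enum_at_codom x a : a \in codom (enum_at x).
Proof. by case/andP: (valP x) => _ /forallP. Qed.

Definition pos x a : 'I_#|N| := iinv (enum_at_codom x a).

Lemma enum_at_pos x a : enum_at x (pos x a) = a.
Proof. exact: f_iinv. Qed.

Lemma pos_enum_at x i : pos x (enum_at x i) = i.
Proof. by apply: (@enum_at_inj x); rewrite enum_at_pos. Qed.

Lemma pos_inj x : injective (pos x).
Proof. exact: can_inj (enum_at_pos x). Qed.

Lemma enumP x y : enum_at x =1 enum_at y -> x = y.
Proof. by move=> xy; apply/val_inj/ffunP. Qed.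

Definition before x a b : bool := pos x a < pos x b.

Lemma before_asym x a b : before x a b -> ~~ before x b a.
Proof. by rewrite /before -leqNgt => /ltnW. Qed.

Lemma before_neq x a b : before x a b -> a != b.
Proof. by apply: contraTneq => ->; rewrite /before ltnn. Qed.

Lemma before_total x a b : a != b -> ~~ before x a b -> before x b a.
Proof.
move=> nab; rewrite /before -leqNgt leq_eqVlt => /orP[/eqP/val_inj/pos_inj ba|//].
by rewrite ba eqxx in nab.
Qed.

End Positions.

(** * Effect of an adjacent transposition on this order *)

Section Edges.
Variable N : finType.
Implicit Types (x y z : enumeration N) (a b c d : N) (i j k : 'I_#|N|).

Lemma swapped_at_edge i j x y : swapped_at i j x y -> permutohedral x y.
Proof. by move=> sw; apply/existsP; exists i; apply/existsP; exists j. Qed.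

Lemma swapped_at_label i j x y :
  swapped_at i j x y -> labelled_edge [set enum_at x i; enum_at x j] x y.
Proof.
by move=> sw; apply/existsP; exists i; apply/existsP; exists j; rewrite sw eqxx.
Qed.

Lemma pos_swapped_at i j x y :
  swapped_at i j x y -> forall c, pos y c = tperm i j (pos x c).
Proof.
case/and4P=> _ /eqP xi /eqP xj /forallP xk c.
rewrite -{1}(enum_at_pos x c); case: tpermP => [->|->|/eqP ni /eqP nj].
- by rewrite xi pos_enum_at.
- by rewrite xj pos_enum_at.
- have /implyP/(_ _)/eqP-> := xk (pos x c); first by rewrite pos_enum_at.
  by rewrite !inE negb_or ni nj.
Qed.

Lemma before_swapped_at i j x y : swapped_at i j x y ->
  before x (enum_at x i) (enum_at x j).
Proof. by case/and4P=> /eqP ij _ _ _; rewrite /before !pos_enum_at ij. Qed.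

Lemma swapped_at_before i j x y : swapped_at i j x y ->
  before y (enum_at x j) (enum_at x i).
Proof.
move=> sw; rewrite /before !(pos_swapped_at sw) !pos_enum_at tpermL tpermR.
by case/and4P: sw => /eqP->.
Qed.

(** No position lies strictly between the consecutive [i] and [j], so exchanging them affects the
    order of no other pair. *)
Lemma before_swapped_at_other i j x y c d : swapped_at i j x y ->
  (c, d) != (enum_at x i, enum_at x j) -> before x c d -> before y c d.
Proof.
move=> sw; have /and4P[/eqP ij _ _ _] := sw => ncd.
have {ncd} : ~ (pos x c = i :> nat /\ pos x d = j :> nat).
  by case=> /val_inj ci /val_inj dj; rewrite -ci -dj !enum_at_pos eqxx in ncd.
rewrite /before !(pos_swapped_at sw).
have ne (k l : 'I_#|N|) : k <> l -> (k : nat) <> l by move=> kl /val_inj.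
by case: tpermP => [->|->|/ne ? /ne ?]; case: tpermP => [->|->|/ne ? /ne ?]; lia.
Qed.

Lemma swapped_at_exists x i j : j = i.+1 :> nat -> exists y, swapped_at i j x y.
Proof.
move=> ij; pose f := [ffun k => enum_at x (tperm i j k)].
have fP : injectiveb f && [forall a, a \in codom f].
  apply/andP; split.
    by apply/injectiveP => k l; rewrite !ffunE => /enum_at_inj/perm_inj.
  apply/forallP => a; apply/codomP; exists (tperm i j (pos x a)).
  by rewrite ffunE tpermK enum_at_pos.
exists (exist _ f fP); apply/and4P; split; first exact/eqP.
- by rewrite {2}/enum_at /= ffunE tpermR.
- by rewrite {2}/enum_at /= ffunE tpermL.
- apply/forallP => k; apply/implyP; rewrite !inE negb_or => /andP[ki kj].
  by rewrite {2}/enum_at /= ffunE tpermD // eq_sym.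
Qed.

(** Counting up from 0 gives [k <= f k]; counting down from the last index gives [f k <= k]. *)
Lemma ord_increasing_id n (f : 'I_n -> 'I_n) :
  (forall i j : 'I_n, j = i.+1 :> nat -> f i < f j) -> f =1 id.
Proof.
move=> fS k; apply/val_inj/eqP; rewrite eqn_leq; apply/andP; split => /=.
  (* Here [m] is the distance from [i] to the last index [n.-1]. *)
  suff H m : forall i : 'I_n, i + m = n.-1 -> f i + m <= n.-1.
    by have := H (n.-1 - k) k; have := ltn_ord k; lia.
  elim: m => [|m IH] i im; first by have := ltn_ord (f i); lia.
  have lt : i.+1 < n by lia.
  have /= := IH (Ordinal lt); have := fS i (Ordinal lt) erefl; lia.
suff H m : forall i : 'I_n, i = m :> nat -> m <= f i by exact: H.
elim: m => [//|m IH] i im.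
have lt : m < n by have := ltn_ord i; lia.
by apply: leq_ltn_trans (IH (Ordinal lt) erefl) (fS _ _ _).
Qed.

(** * Pairs reversed between two enumerations *)

Definition disagree x y : {set N * N} :=
  [set p | before x p.1 p.2 && before y p.2 p.1].

(** If [y] reverses no two neighbours of [x], the map from positions in [x] to positions in [y] is
    increasing, hence the identity. *)
Lemma exists_descent x y : x <> y ->
  exists i, exists j, exists z,
    swapped_at i j x z /\ before y (enum_at x j) (enum_at x i).
Proof.
move=> xy.
case: (boolP [exists i : 'I_#|N|, exists j : 'I_#|N|,
  (j == i.+1 :> nat) && before y (enum_at x j) (enum_at x i)]).
  case/existsP=> i /existsP[j /andP[/eqP ij yji]].
  by have [z sw] := swapped_at_exists x ij; exists i, j, z.
rewrite negb_exists => /forallP H; case: xy; apply: enumP => k.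
rewrite -[LHS](enum_at_pos y); congr enum_at.
apply: (@ord_increasing_id _ (fun k => pos y (enum_at x k))).
move=> i j ij; have := H i; rewrite negb_exists => /forallP/(_ j).
rewrite ij eqxx /= => /before_total; apply.
by rewrite (inj_eq (@enum_at_inj _ x)) -val_eqE /= ij gtn_eqF.
Qed.

Lemma disagree_edge i j x y z : swapped_at i j x y ->
  disagree x z \subset (enum_at x i, enum_at x j) |: disagree y z.
Proof.
move=> sw; apply/subsetP => -[c d]; rewrite !inE /= => /andP[xcd ->].
rewrite andbT; case: eqP => //= /eqP ncd.
exact: before_swapped_at_other sw ncd xcd.
Qed.

Lemma card_disagree_edge i j x y z : swapped_at i j x y ->
  #|disagree x z| <= #|disagree y z|.+1.
Proof.
move=> /disagree_edge-/(_ z)/subset_leq_card/leq_trans; apply.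
by rewrite cardsU1; case: (_ \notin _).
Qed.

Lemma disagree_edge_farther i j x y z : swapped_at i j x y ->
  ~~ before z (enum_at x j) (enum_at x i) -> disagree x z \subset disagree y z.
Proof.
move=> sw nz; apply/subsetP => p px; have := subsetP (disagree_edge z sw) _ px.
case/setU1P=> // pE; move: px nz; rewrite pE inE /=.
by case/andP=> _ ->.
Qed.

Lemma card_disagree_descent i j x y z : swapped_at i j x y ->
  before z (enum_at x j) (enum_at x i) ->
  #|disagree x z| = #|disagree y z|.+1.
Proof.
move=> sw zji; rewrite (cardsD1 (enum_at x i, enum_at x j)) inE /= zji.
rewrite (before_swapped_at sw); congr _.+1; apply: eq_card => -[c d].
rewrite in_setD1 !inE /=; apply/andP/andP => [[ncd /andP[xcd ->]]|[ycd zdc]].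
  by split=> //; apply: before_swapped_at_other sw ncd xcd.
split.
  by apply: contraTneq ycd => -[-> ->]; apply/before_asym/swapped_at_before.
rewrite zdc andbT; apply: contraTT ycd => nxcd.
(* If [x] had [d] before [c], so would [y], unless the edge swaps exactly this pair; but [z] orders
   the swapped pair the other way. *)
have [[dE cE]|/eqP ne] := @eqP _ (d, c) (enum_at x i, enum_at x j).
  by rewrite dE cE (negbTE (before_asym zji)) in zdc.
apply: before_asym; apply: before_swapped_at_other sw ne _.
by apply: before_total nxcd; rewrite eq_sym (before_neq zdc).
Qed.

End Edges.

(** * Distances and geodesics in the permutohedral graph *)

Section Convexity.
Variable N : finType.
Implicit Types (x y z : enumeration N) (a b c d : N) (i j k : 'I_#|N|).
Implicit Types (S : {set enumeration N}) (P : {set N * N}).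

Let convex S := geodetically_convex (@permutohedral N) S.

Lemma disagree_eq0 x y : disagree x y = set0 -> x = y.
Proof.
move=> D0; apply: contrapT => /exists_descent[i [j [z [sw yji]]]].
by have := card_disagree_descent sw yji; rewrite D0 cards0.
Qed.

Lemma card_disagree_refl x : #|disagree x x| = 0.
Proof.
apply: eq_card0 => -[c d]; rewrite inE /=.
by apply/negP => /andP[/before_asym/negP].
Qed.

(** Bubble sort: each descent towards [y] removes one reversed pair. *)
Lemma walk_exists x y :
  exists2 p, walk (@permutohedral N) x y p & size p = #|disagree x y|.
Proof.
move: {2}#|disagree x y| (erefl #|disagree x y|) => m.
elim: m x => [|m IH] x Dm.
  exists [::]; last by rewrite Dm.
  by split=> //=; apply: disagree_eq0; apply/eqP; rewrite -cards_eq0 Dm.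
have /exists_descent[i [j [z [sw yji]]]] : x <> y.
  by move=> xy; rewrite xy card_disagree_refl in Dm.
have Ez := card_disagree_descent sw yji.
have [|p [zp zy] pm] := IH z; first by lia.
exists (z :: p); last by rewrite Ez /= pm.
by split=> //=; rewrite (swapped_at_edge sw).
Qed.

Lemma card_disagree_walk x y p :
  walk (@permutohedral N) x y p -> #|disagree x y| <= size p.
Proof.
elim: p x => [|z p IH] x [/= xp xy]; first by rewrite xy card_disagree_refl.
case/andP: xp => /existsP[i /existsP[j sw]] zp.
by apply: leq_trans (card_disagree_edge y sw) _; rewrite ltnS IH.
Qed.

Lemma geodesicP x y p : geodesic (@permutohedral N) x y p <->
  walk (@permutohedral N) x y p /\ size p = #|disagree x y|.
Proof.
split=> [[wp pmin]|[wp pD]]; split=> //.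
  have [q wq qD] := walk_exists x y.
  by apply/eqP; rewrite eqn_leq card_disagree_walk // -qD pmin.
by move=> q /card_disagree_walk; rewrite pD.
Qed.

(** Every edge of a geodesic is a descent towards [y], so it never reverses a pair already ordered
    as in [y]. *)
Lemma before_geodesic x y p c d : geodesic (@permutohedral N) x y p ->
  before x c d -> before y c d -> {in x :: p, forall z, before z c d}.
Proof.
move=> /geodesicP; elim: p x => [|w p IH] x [[/= xp xy] /= pD] xcd ycd z.
  by rewrite inE => /eqP->.
rewrite inE => /predU1P[-> //|].
case/andP: xp => /existsP[i /existsP[j sw]] wp.
have ww : walk (@permutohedral N) w y p by [].
have wD := card_disagree_walk ww.
have wxD := card_disagree_edge y sw; rewrite -pD ltnS in wxD.
have yji : before y (enum_at x j) (enum_at x i).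
  (* Otherwise the reversed pairs would number at most [size p], one less than the length of the
     geodesic. *)
  apply/negPn/negP => /(disagree_edge_farther sw)/subset_leq_card.
  by move/leq_trans/(_ wD); rewrite -pD ltnn.
apply: (IH w) => //; first by split=> //; apply/eqP; rewrite eqn_leq wxD.
apply: before_swapped_at_other sw _ xcd.
by apply: contraTneq ycd => -[-> ->]; apply: before_asym.
Qed.

(** A descent from [x] towards [y] is the first edge of some geodesic to [y]. *)
Lemma convex_edge S i j x y z : convex S -> x \in S -> y \in S ->
  swapped_at i j x z -> before y (enum_at x j) (enum_at x i) -> z \in S.
Proof.
move=> cS xS yS sw yji; have [p wp pD] := walk_exists z y.
apply: (cS x y xS yS (z :: p)); last by rewrite !inE eqxx orbT.
apply/geodesicP; case: wp => zp zy; split.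
  by split=> //=; rewrite (swapped_at_edge sw).
by rewrite /= pD (card_disagree_descent sw yji).
Qed.

(** * Convex sets described by ordered pairs *)

Definition respecting P : {set enumeration N} :=
  [set x | [forall p in P, before x p.1 p.2]].

Definition common S : {set N * N} :=
  [set p | [forall x in S, before x p.1 p.2]].

Lemma respectingP P x :
  reflect (forall c d, (c, d) \in P -> before x c d) (x \in respecting P).
Proof.
rewrite inE; apply: (iffP forall_inP) => [H c d /H //|H [c d] /H //].
Qed.

Lemma commonP S c d :
  reflect (forall x, x \in S -> before x c d) ((c, d) \in common S).
Proof. by rewrite inE; apply: forall_inP. Qed.

Lemma convex_respecting P : convex (respecting P).
Proof.
move=> x y /respectingP xP /respectingP yP p gp z zp.
apply/respectingP => c d cdP.
by apply: before_geodesic gp (xP _ _ _) (yP _ _ _) z zp.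
Qed.

(* The member of [S] closest to a respecting enumeration must equal it: an edge
   towards it reverses a pair reversed by some member too, so it stays in [S]. *)
Lemma respecting_common S x0 : convex S -> x0 \in S ->
  respecting (common S) \subset S.
Proof.
move=> cS x0S; apply/subsetP => y /respectingP yP.
have [x xS xmin] := @arg_minnP _ x0 (mem S) (fun x => #|disagree x y|) x0S.
have [<- //|/eqP/exists_descent[i [j [z [sw yji]]]]] := eqVneq x y.
have : (enum_at x i, enum_at x j) \notin common S.
  by apply: contraTN yji => /yP/before_asym.
rewrite inE negb_forall_in => /exists_inP[w wS /=].
have nij := before_neq (before_swapped_at sw).
move=> /(before_total nij) wji; have zS := convex_edge cS xS wS sw wji.
by have := xmin z zS; rewrite (card_disagree_descent sw yji) ltnn.
Qed.

(** * Inversions within convex sets *)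

Lemma mem_Inv S i j x y : x \in S -> y \in S -> swapped_at i j x y ->
  [set enum_at x i; enum_at x j] \in Inv S.
Proof.
move=> xS yS sw; rewrite inE; apply/exists_inP; exists x => //.
by apply/exists_inP; exists y => //; apply: swapped_at_label.
Qed.

Lemma InvP S (A : {set N}) : A \in Inv S ->
  exists i, exists j, exists x, exists y,
    [/\ x \in S, y \in S, swapped_at i j x y &
        A = [set enum_at x i; enum_at x j]].
Proof.
rewrite inE => /exists_inP[x xS /exists_inP[y yS]].
by case/existsP=> i /existsP[j /andP[sw /eqP AE]]; exists i, j, x, y.
Qed.

(** Descents from [x] to [y] stay in [S], and one of them must reverse [(c, d)]. *)
Lemma Inv_disagree S x y c d : convex S -> x \in S -> y \in S ->
  before x c d -> before y d c -> [set c; d] \in Inv S.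
Proof.
move=> cS + yS + ydc; move: {2}#|disagree x y| (erefl #|disagree x y|) => m.
elim: m x => [|m IH] x Dm xS xcd.
  have xy : x = y by apply: disagree_eq0; apply/eqP; rewrite -cards_eq0 Dm.
  by rewrite -xy (negbTE (before_asym xcd)) in ydc.
have /exists_descent[i [j [z [sw yji]]]] : x <> y.
  by move=> xy; rewrite xy card_disagree_refl in Dm.
have zS := convex_edge cS xS yS sw yji.
have [[-> ->]|/eqP ncd] := @eqP _ (c, d) (enum_at x i, enum_at x j).
  exact: mem_Inv zS sw.
apply: (IH z) => //; last exact: before_swapped_at_other sw ncd xcd.
by have := card_disagree_descent sw yji; lia.
Qed.

(** Descents from [x] to [y] stay in [S']; the first one to leave [S] is the required edge. *)
Lemma exit_edge S S' x y : convex S' -> S \subset S' ->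
  x \in S -> y \in S' -> y \notin S ->
  exists i, exists j, exists u, exists v,
    [/\ u \in S, v \in S', v \notin S & swapped_at i j u v].
Proof.
move=> cS' SS' + yS' yS; move: {2}#|disagree x y| (erefl #|disagree x y|) => m.
elim: m x => [|m IH] x Dm xS.
  have xy : x = y by apply: disagree_eq0; apply/eqP; rewrite -cards_eq0 Dm.
  by rewrite -xy xS in yS.
have /exists_descent[i [j [z [sw yji]]]] : x <> y.
  by move=> xy; rewrite xy card_disagree_refl in Dm.
have zS' := convex_edge cS' (subsetP SS' _ xS) yS' sw yji.
case: (boolP (z \in S)) => [zS|zS]; last by exists i, j, x, z.
by apply: (IH z) => //; have := card_disagree_descent sw yji; lia.
Qed.

(** If the reversed pair were not common, [v] would still respect [common S] and so lie in [S]. *)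
Lemma exit_edge_common S i j u v : convex S -> u \in S -> v \notin S ->
  swapped_at i j u v -> (enum_at u i, enum_at u j) \in common S.
Proof.
move=> cS uS vS sw; apply: contraNT vS => nij.
apply: (subsetP (respecting_common cS uS)); apply/respectingP => c d cd.
apply: before_swapped_at_other sw _ _; first by apply: contraNneq nij => <-.
by move/commonP: cd; apply.
Qed.

(** The two ends of an edge order its label oppositely, whereas members of [S] agree on common
    pairs. *)
Lemma common_notin_Inv S a b : (a, b) \in common S -> [set a; b] \notin Inv S.
Proof.
move/commonP=> ab; apply/negP => /InvP[i [j [x [y [xS yS sw AE]]]]].
have xab := ab _ xS; have xij := before_swapped_at sw.
have : a \in [set enum_at x i; enum_at x j] by rewrite -AE set21.
have : b \in [set enum_at x i; enum_at x j] by rewrite -AE set22.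
case/set2P=> bE /set2P[] aE; move: (ab _ yS) xab; rewrite aE bE.
- by rewrite /before ltnn.
- by rewrite (negbTE (before_asym xij)).
- by rewrite (negbTE (before_asym (swapped_at_before sw))).
- by rewrite /before ltnn.
Qed.

Lemma Inv_sub S S' : S \subset S' -> Inv S \subset Inv S'.
Proof.
move=> /subsetP SS'; apply/subsetP => A /InvP[i [j [x [y [xS yS sw ->]]]]].
exact: mem_Inv (SS' _ xS) (SS' _ yS) sw.
Qed.

Lemma convex1 x : convex [set x].
Proof.
move=> y z /set1P-> /set1P-> p /geodesicP[_].
by rewrite card_disagree_refl => /size0nil-> w; rewrite !inE.
Qed.

Lemma Inv1 x : Inv [set x] = set0.
Proof.
apply/setP => A; rewrite in_set0; apply/negP => /InvP[i [j [y [z]]]].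
case=> /set1P-> /set1P-> sw _.
by have := before_asym (before_swapped_at sw); rewrite (swapped_at_before sw).
Qed.

Lemma card_Inv_lt S S' x : convex S -> convex S' -> S \proper S' -> x \in S ->
  #|Inv S| < #|Inv S'|.
Proof.
move=> cS cS' /properP[SS' [y yS' yS]] xS.
have [i [j [u [v [uS vS' vS sw]]]]] := exit_edge cS' SS' xS yS' yS.
apply/proper_card/properP; split; first exact: Inv_sub.
exists [set enum_at u i; enum_at u j].
  exact: mem_Inv (subsetP SS' _ uS) vS' sw.
exact/common_notin_Inv/(exit_edge_common cS uS vS sw).
Qed.

(** Dropping from [common S] the one pair reversed by an exit edge enlarges [S] by as little as the
    count of inversions can register. *)
Lemma convex_between S S' x : convex S -> convex S' -> S \proper S' ->
  x \in S -> exists T, [/\ convex T, S \proper T, T \subset S' &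
    #|Inv T| <= #|Inv S|.+1].
Proof.
move=> cS cS' /properP[SS' [y yS' yS]] xS.
have [i [j [u [v [uS vS' vS sw]]]]] := exit_edge cS' SS' xS yS' yS.
pose a := enum_at u i; pose b := enum_at u j.
have abS : (a, b) \in common S := exit_edge_common cS uS vS sw.
have ST w : w \in S -> w \in respecting (common S :\ (a, b)).
  move=> wS; apply/respectingP => c d.
  by rewrite in_setD1 => /andP[_ /commonP]; apply.
exists (respecting (common S :\ (a, b))); split.
- exact: convex_respecting.
- apply/properP; split; first by apply/subsetP => w; apply: ST.
  (* [v] is new: it differs from [u] in the order of the dropped pair only. *)
  exists v => //; apply/respectingP => c d.
  rewrite in_setD1 => /andP[ncd /commonP cd].
  exact: before_swapped_at_other sw ncd (cd _ uS).
(* Common pairs of [S'] are common to [S], and [(a, b)] is not among them because [v] reverses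
   it. *)
- apply: subset_trans (respecting_common cS' vS').
  apply/subsetP => w /respectingP wT; apply/respectingP => c d /commonP cd.
  apply: wT; rewrite in_setD1; apply/andP; split; last first.
    by apply/commonP => z zS; apply: cd; apply: (subsetP SS').
  apply: contraTneq (cd _ vS') => -[-> ->].
  exact/before_asym/(swapped_at_before sw).
suff H : Inv (respecting (common S :\ (a, b))) \subset [set a; b] |: Inv S.
  apply: leq_trans (subset_leq_card H) _.
  by rewrite cardsU1; case: (_ \notin _).
apply/subsetP => A /InvP[k [l [w [z [/respectingP wT /respectingP zT klz ->]]]]].
set c := enum_at w k; set d := enum_at w l; apply/setU1P.
have wcd : before w c d := before_swapped_at klz.
have zdc : before z d c := swapped_at_before klz.
have [[-> ->]|/eqP ncd] := @eqP _ (c, d) (a, b); first by left.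
have [[-> ->]|/eqP ndc] := @eqP _ (d, c) (a, b); first by left; rewrite setUC.
right.
(* A pair other than [(a, b)] that is common to [S] is still respected by both [w] and [z], which
   disagree on [c] and [d]. Hence two members of [S] disagree on them too. *)
have : (c, d) \notin common S.
  apply: contraTN zdc => cdS; apply: before_asym; apply: zT.
  by rewrite in_setD1 ncd.
have : (d, c) \notin common S.
  apply: contraTN wcd => dcS; apply: before_asym; apply: wT.
  by rewrite in_setD1 ndc.
have ne := before_neq wcd.
rewrite ![_ \in common S]inE !negb_forall_in => /exists_inP[p pS pdc] /exists_inP[q qS qcd].
apply: (Inv_disagree cS pS qS); last exact: before_total qcd.
by apply: before_total pdc; rewrite eq_sym.
Qed.

End Convexity.

(** * Strict monotonicity and unit steps along covers *)

Theorem corollary6 (N : finType) (hN : 2 <= #|N|) :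
  height_function
    (fun S : convex_set (@permutohedral N) => card_Inv (cset S)).
Proof.
have cvx (A : convex_set (@permutohedral N)) :
  geodetically_convex (@permutohedral N) A.
  exact/asboolP/csetP.
have ltE (A B : convex_set (@permutohedral N)) :
  (A < B)%O = (cset A \proper cset B).
  rewrite Order.POrderTheory.lt_neqAle properEneq.
  by congr (_ && _); rewrite -(inj_eq val_inj).
have mk (T : {set enumeration N}) : geodetically_convex (@permutohedral N) T ->
  exists B : convex_set (@permutohedral N), cset B = T.
  by move=> cT; exists (ConvexSet (introT (asboolP _) cT)).
have ltI (A B : convex_set (@permutohedral N)) : (A < B)%O ->
    (card_Inv (cset A) < card_Inv (cset B))%R.
  rewrite ltE /card_Inv => AB; have /properP[_ [y yB _]] := AB.
  have -> : (cset B == set0) = false by apply/negbTE/set0Pn; exists y.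
  have [_ //|/set0Pn[x xA]] := eqVneq (cset A) set0.
  by rewrite ltz_nat (card_Inv_lt (cvx A) (cvx B) AB xA).
move=> A B; split=> [|[AB noC]]; first exact: ltI.
have AB' := AB; rewrite ltE in AB'.
have /properP[sAB [y yB _]] := AB'.
have B0 : (cset B == set0) = false by apply/negbTE/set0Pn; exists y.
have coverE (C : convex_set (@permutohedral N)) :
    cset A \proper cset C -> cset C \subset cset B -> cset C = cset B.
  move=> AC CB; apply/eqP; apply/negPn/negP => nCB; case: noC; exists C.
  by rewrite !ltE AC properEneq nCB.
have [A0|/set0Pn[x xA]] := eqVneq (cset A) set0.
  (* A cover of the empty set is a singleton, which has no inversions: the value rises from -1 to
     0. *)
  have [C CE] := mk _ (@convex1 _ y).
  rewrite -(coverE C) ?CE ?A0 ?sub1set ?proper0 //; last first.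
    by apply/set0Pn; exists y; rewrite inE.
  rewrite /card_Inv Inv1 cards0 eqxx ifF //.
  by apply/negbTE/set0Pn; exists y; rewrite inE.
have [T [cT AT TB Tcard]] := convex_between (cvx A) (cvx B) AB' xA.
have [C CE] := mk _ cT; move: (coverE C); rewrite CE => /(_ AT TB) TE.
(* Strict growth and the bound [Tcard] leave exactly one new inversion. *)
rewrite TE in Tcard; have := card_Inv_lt (cvx A) (cvx B) AB' xA.
rewrite /card_Inv B0 ifF; last by apply/negbTE/set0Pn; exists x.
lia.
Qed.
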